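(* Let $S^n$ be the $n$-dimensional unit sphere. If $\phi_0,\phi_1:S^n\to\mathbb{R}$ are $c$-convex, then for each $t\in[0,1]$ the function $x\mapsto (1-t)\phi_0(x)+t\phi_1(x)$ is also $c$-convex.
   Context: $S^n\subset\mathbb{R}^{n+1}$ is the $n$-dimensional unit sphere with its standard Riemannian metric; $d(x,y)=\cos^{-1}(x^{\top}y)\in[0,\pi]$ is the geodesic distance, and the cost function is $c(x,y)=\frac12 d(x,y)^2$. The $c$-transform of a function $\phi:S^n\to\mathbb{R}$ is $\phi^c(y)=\sup_{x\in S^n}\{-c(x,y)-\phi(x)\}$, $y\in S^n$. The function $\phi$ is called $c$-convex (cost-convex) if $(\phi^c)^c=\phi$. *)

(* Defs.v *)
(* MathComp-Analysis: the reals are an arbitrary R : realType. *)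
From HB Require Import structures.
From mathcomp Require Import all_boot all_order all_algebra.
From mathcomp Require Import all_classical all_reals all_analysis.

Set Implicit Arguments.
Unset Strict Implicit.
Unset Printing Implicit Defensive.

Import Order.TTheory GRing.Theory Num.Theory.
Local Open Scope classical_set_scope.
Local Open Scope ring_scope.

Definition dot (R : realType) (m : nat) (x y : 'cV[R]_m) : R :=
  (x^T *m y) 0 0.

Definition sphere (R : realType) (n : nat) : Type :=
  {x : 'cV[R]_n.+1 | dot x x == 1}.

(* On the sphere [dot] takes values in [-1, 1], where [acos] is the genuine
   inverse of cos on [0, pi]. *)
Definition gdist (R : realType) (n : nat) (x y : sphere R n) : R :=
  acos (dot (val x) (val y)).

Definition cost (R : realType) (n : nat) (x y : sphere R n) : R :=
  2^-1 * gdist x y ^+ 2.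

(* The transform is extended-real valued: the supremum is +oo when f is not
   bounded below, and its iterate needs extended-real arguments.  As the cost
   is finite, no indeterminate form oo - oo arises. *)
Definition ctransform (R : realType) (n : nat) (f : sphere R n -> \bar R)
    (y : sphere R n) : \bar R :=
  ereal_sup [set (- (cost x y)%:E - f x)%E | x in [set: sphere R n]].

Definition cconvex (R : realType) (n : nat) (phi : sphere R n -> R) : Prop :=
  ctransform (ctransform (fun x => (phi x)%:E)) = (fun x => (phi x)%:E).

(* Main.v *)
Require Import Defs.
From mathcomp Require Import all_boot all_order all_algebra.
From mathcomp Require Import all_classical all_reals all_analysis.
From mathcomp Require Import ring lra.
Set Implicit Arguments.
Unset Strict Implicit.
Unset Printing Implicit Defensive.
Import Order.TTheory GRing.Theory Num.Theory.
Import numFieldNormedType.Exports.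
Local Open Scope ring_scope.

(** A function phi is cost-convex exactly when, at every point x and up to an
    arbitrarily small error, it is supported by a function
    y |-> phi x + cost x z - cost y z ([cconvex_supportP]).  Taking the convex
    combination of two supports at x, with poles y0 and y1, it remains to find
    one pole z whose support at x lies below that combination ([c_segment]).

    Write y0 and y1 as exp_x v0 and exp_x v1 with tangent vectors of length at
    most pi, and put z := exp_x ((1 - t) v0 + t v1).  Since cost x (exp_x v) is
    |v|^2 / 2 on the ball of radius pi, what has to be proved is that, for each
    fixed y, the function v |-> |v|^2 - d(y, exp_x v)^2 is convex on that ball
    ([acos_exp_convex]).  This is the nonnegative cross-curvature of the sphere.

    On a line of the tangent space it becomes the sign of a second derivative.
    At a point v with |v| = r and d(y, exp_x v) = th, this derivative is a
    quadratic form in the direction of the line, split into its radial and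
    tangential parts, and its positivity is a discriminant condition
    ([cross_curvature_ge0]).  The condition says precisely that the function
    w(th) = th^2 / (1 - th cot th) lies below its tangent at r, so everything
    rests on the concavity of w on the interval from 0 to pi
    ([cot_ratio_tangent]).  That concavity reduces in turn to three elementary
    inequalities between th, sin th and cos th.

    The squared distance to y is not differentiable at the antipode of y.  To
    keep away from it, y is first replaced by the vector k y with k < 1, so that
    the inner products stay strictly between -1 and 1, and k tends to 1 at the
    end ([acos_convex_limit]). *)

(** * Convexity from the second derivative *)

Lemma is_derive_le (R : realType) (f df : R -> R) (a b : R) : a <= b ->
  (forall x, a <= x <= b -> is_derive x 1 f (df x)) ->
  (forall x, a < x < b -> 0 <= df x) -> f a <= f b.
Proof.
rewrite le_eqVlt => /predU1P[->|ab] Df df0; first by [].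
have [x /[!in_itv]/= /andP[ax xb]|c|c] := @MVT R f df a b ab.
- by apply: Df; rewrite !ltW.
- apply: derivable_within_continuous => x /[!in_itv]/= /Df D; exact: ex_derive.
rewrite in_itv/= => /df0 dc e; rewrite -subr_ge0 e.
by rewrite mulr_ge0// subr_ge0 ltW.
Qed.

(** The first derivative is monotone, so subtracting the tangent leaves a function
    which decreases before the point of contact and increases after it. *)
Lemma tangent_below (R : realType) (f df ddf : R -> R) (a b m x : R) :
  (forall y : R, a <= y <= b -> is_derive y 1 f (df y)) ->
  (forall y : R, a <= y <= b -> is_derive y 1 df (ddf y)) ->
  (forall y, a < y < b -> 0 <= ddf y) ->
  a <= m <= b -> a <= x <= b -> f m + df m * (x - m) <= f x.
Proof.
move=> D1 D2 d0 /andP[am mb] /andP[ax xb].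
have dfle y z : a <= y -> y <= z -> z <= b -> df y <= df z.
  move=> ay yz zb; apply: (@is_derive_le _ df ddf) => // [u /andP[yu uz]|].
    by apply: D2; rewrite (le_trans ay) ?(le_trans uz).
  by move=> u /andP[yu uz]; apply: d0; rewrite (le_lt_trans ay) ?(lt_le_trans uz).
pose g (y : R) := f y - df m * y; pose dg (y : R) := df y - df m.
have Dg (y : R) : a <= y <= b -> is_derive y 1 g (dg y).
  by move=> /D1 ?; apply: is_derive_eq; rewrite /GRing.scale/= mulr1.
suff gmx : g m <= g x.
  rewrite -subr_ge0 (_ : _ - _ = g x - g m) ?subr_ge0//.
  by rewrite /g; ring.
have [xm|mx] := leP x m.
  rewrite -lerN2; pose h y := - g y; pose dh y := - dg y.
  apply: (@is_derive_le _ h dh x m xm) => y /andP[xy ym].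
    by have := Dg y; rewrite (le_trans ax) ?(le_trans ym)// => /(_ isT) D;
      exact: is_deriveN.
  by rewrite oppr_ge0 subr_le0 dfle// ?(le_trans ax) ?ltW.
apply: (@is_derive_le _ g dg m x (ltW mx)) => y /andP[my yx].
  by apply: Dg; rewrite (le_trans am) ?(le_trans yx).
by rewrite subr_ge0 dfle// ?(ltW my)// (le_trans (ltW yx)).
Qed.

(** The chord is compared with the tangent at the intermediate point, which lies
    below the function at both ends.  Only the sign of the second derivative is
    local to the interval; differentiability everywhere avoids any discussion
    of the end points. *)
Lemma convex_of_second_derivative (R : realType) (f df ddf : R -> R)
    (a b t : R) : a <= b -> 0 <= t <= 1 ->
  (forall x : R, is_derive x 1 f (df x)) ->
  (forall x : R, is_derive x 1 df (ddf x)) ->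
  (forall x, a < x < b -> 0 <= ddf x) ->
  f ((1 - t) * a + t * b) <= (1 - t) * f a + t * f b.
Proof.
move=> ab /andP[t0 t1] D1 D2 d0; set m := (1 - t) * a + t * b.
have t1' : 0 <= 1 - t by rewrite subr_ge0.
have amb : a <= m <= b.
  rewrite -subr_ge0 -[m <= b]subr_ge0.
  rewrite (_ : m - a = t * (b - a)); last by rewrite /m; ring.
  rewrite (_ : b - m = (1 - t) * (b - a)); last by rewrite /m; ring.
  by rewrite !mulr_ge0 ?subr_ge0.
have supp x : a <= x <= b -> f m + df m * (x - m) <= f x.
  by apply: (@tangent_below _ f df ddf).
have ha : f m + df m * (a - m) <= f a by apply: supp; rewrite lexx.
have hb : f m + df m * (b - m) <= f b by apply: supp; rewrite lexx andbT.
have -> : f m = (1 - t) * (f m + df m * (a - m)) + t * (f m + df m * (b - m)).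
  by rewrite /m; ring.
by rewrite lerD// ler_wpM2l.
Qed.

(** * Trigonometric inequalities on the interval from 0 to pi *)

Section Trig.
Variable R : realType.
Implicit Types x r m : R.

(** This is x^2 j_1(x), with j_1 the spherical Bessel function of order 1; also
    1 - x cot x = sin_gap x / sin x. *)
Definition sin_gap x := sin x - x * cos x.

(** Up to the factor - x / sin_gap x ^+ 2, the derivative of
    x^2 / (1 - x cot x); see [is_derive_cot_ratio]. *)
Definition sq_gap x := x ^+ 2 + x * sin x * cos x - 2 * sin x ^+ 2.

Lemma is_derive_sin_gap x : is_derive x 1 sin_gap (x * sin x).
Proof. by apply: is_derive_eq; rewrite !/GRing.scale /=; ring. Qed.

(** The inequalities below are all equalities at 0, so they follow from the same
    kind of inequality between derivatives; the hypotheses are shaped for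
    repeated use of that remark. *)
Lemma ge0_of_derive (f df : R -> R) x : 0 <= x <= pi -> f 0 = 0 ->
  (forall y : R, is_derive y 1 f (df y)) ->
  (forall y, 0 < y < pi -> 0 <= df y) -> 0 <= f x.
Proof.
move=> /andP[x0 xpi] f0 Df df0; rewrite -f0.
apply: (@is_derive_le _ f df) => // y /andP[y0 yx].
by apply: df0; rewrite y0 (lt_le_trans yx).
Qed.

Lemma sin_gap_ge0 x : 0 <= x <= pi -> 0 <= sin_gap x.
Proof.
move=> xpi; apply: (@ge0_of_derive sin_gap (fun y => y * sin y)) => //.
- by rewrite /sin_gap sin0 mul0r subrr.
- exact: is_derive_sin_gap.
- by move=> y ypi; rewrite mulr_ge0 ?ltW ?sin_gt0_pi//; case/andP: ypi.
Qed.

(** The second derivative of [sq_gap] is 4 sin x * sin_gap x. *)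
Lemma sq_gap_ge0 x : 0 <= x <= pi -> 0 <= sq_gap x.
Proof.
move=> xpi.
pose dj (y : R) := 2 * y - 3 * sin y * cos y + y * (1 - 2 * sin y ^+ 2).
apply: (@ge0_of_derive sq_gap dj) => //.
- by rewrite /sq_gap sin0; ring.
- move=> y; apply: is_derive_eq; rewrite !/GRing.scale /= /dj.
  by ring: (sin2cos2 y).
move=> y /andP[y0 /ltW ypi].
apply: (@ge0_of_derive dj (fun z => 4 * sin z * sin_gap z)).
- by rewrite ypi ltW.
- by rewrite /dj sin0; ring.
- move=> z; apply: is_derive_eq; rewrite !/GRing.scale /= /sin_gap.
  by ring: (sin2cos2 z).
move=> z zpi; have [z0 zp] := andP zpi.
by rewrite !mulr_ge0 ?(ltW (sin_gt0_pi zpi)) ?sin_gap_ge0// !ltW.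
Qed.

(** A truncation of the continued fraction of 1 - x cot x.  In terms of
    w = x^2 / (1 - x cot x) it says w <= 3 - x^2 / 5, the first two terms of the
    expansion of w at 0. *)
Lemma sin_gap_lb x : 0 <= x <= pi ->
  5 * x ^+ 2 * sin x <= (15 - x ^+ 2) * sin_gap x.
Proof.
move=> xpi; rewrite -subr_ge0.
pose i1 (y : R) := 3 * sin_gap y - y ^+ 2 * sin y.
pose i0 (y : R) := (15 - y ^+ 2) * sin_gap y - 5 * y ^+ 2 * sin y.
apply: (@ge0_of_derive i0 (fun y => y * i1 y)) => //.
- by rewrite /i0 /sin_gap sin0; ring.
- move=> y; have := @is_derive_sin_gap => Db; apply: is_derive_eq.
  by rewrite !/GRing.scale /= /i1 /sin_gap; ring.
move=> y /andP[y0 /ltW ypi]; rewrite mulr_ge0 ?(ltW y0)//.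
apply: (@ge0_of_derive i1 (fun z => z * sin_gap z)).
- by rewrite ypi ltW.
- by rewrite /i1 /sin_gap sin0; ring.
- move=> z; have := @is_derive_sin_gap => Db; apply: is_derive_eq.
  by rewrite !/GRing.scale /= /sin_gap; ring.
move=> z /andP[z0 zp].
by rewrite mulr_ge0 ?sin_gap_ge0// !ltW.
Qed.

Lemma pi_lt4 : pi < 4 :> R.
Proof. by have /andP[_] := pihalf_02 R; rewrite ltr_pdivrMr// -natrM. Qed.

Lemma sin_gap_gt0 x : 0 < x < pi -> 0 < sin_gap x.
Proof.
move=> xpi; have [x0 xp] := andP xpi.
have := sin_gt0_pi xpi; have := pi_lt4 => p4.
have : 5 * x ^+ 2 * sin x <= (15 - x ^+ 2) * sin_gap x.
  by apply: sin_gap_lb; rewrite !ltW.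
have : 0 <= sin_gap x by apply: sin_gap_ge0; rewrite !ltW.
rewrite le_eqVlt => /predU1P[<-|//]; rewrite mulr0 => h s0.
by move: h; rewrite leNgt !mulr_gt0// exprn_gt0.
Qed.

(** The function x^2 / (1 - x cot x).  Since 1 - x cot x is the sum over k >= 1 of
    2 x^2 / (k^2 pi^2 - x^2), it is the inverse of the sum of the inverses of the
    concave functions (k^2 pi^2 - x^2) / 2, which is a conceptual reason for its
    concavity; the proof below is a direct computation. *)
Definition cot_ratio x := x ^+ 2 * sin x / sin_gap x.

Lemma is_derive_sq_gap x :
  is_derive x 1 sq_gap
    (2 * x - 3 * sin x * cos x + x * (1 - 2 * sin x ^+ 2)).
Proof.
apply: is_derive_eq; rewrite !/GRing.scale /=.
by ring: (sin2cos2 x).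
Qed.

Lemma is_derive_cot_ratio x : sin_gap x != 0 ->
  is_derive x 1 cot_ratio (- (x * sq_gap x / sin_gap x ^+ 2)).
Proof.
move=> B0; have Db := is_derive_sin_gap x; have DV := is_deriveV B0 Db.
apply: is_derive_eq; rewrite !/GRing.scale /=.
move: B0; rewrite /sq_gap /sin_gap => B0.
by field: (sin2cos2 x).
Qed.

(** Minus the second derivative of [cot_ratio]. *)
Definition cot_ratio_concavity x :=
  2 * (sin_gap x ^+ 3 + (sin_gap x - x ^+ 2 * sin x) * sq_gap x) / sin_gap x ^+ 3.

Lemma is_derive2_cot_ratio x : sin_gap x != 0 ->
  is_derive x 1 (fun y => y * sq_gap y / sin_gap y ^+ 2) (cot_ratio_concavity x).
Proof.
move=> B0; have Db := is_derive_sin_gap x.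
have B20 : sin_gap x ^+ 2 != 0 by rewrite expf_neq0.
have D2 : is_derive x 1 (fun y => sin_gap y ^+ 2) (2 * sin_gap x * (x * sin x)).
  by apply: is_derive_eq; rewrite /GRing.scale/=; ring.
have DV := @is_deriveV R (fun y => sin_gap y ^+ 2) x _ 1 B20 D2.
have Dj := is_derive_sq_gap x.
apply: is_derive_eq; rewrite !/GRing.scale /= /cot_ratio_concavity.
move: B0; rewrite /sq_gap /sin_gap => B0.
by field: (sin2cos2 x).
Qed.

(** With w = [cot_ratio] x, equal to a / B below, the claim is clear from
    [sq_gap_ge0] when w <= 1.  When w > 1, the bound of [sin_gap_lb] reduces it to
    w^2 - 6 w + 10 >= 0, that is (w - 3)^2 + 1 >= 0. *)
Lemma cot_ratio_concavity_ge0 x : 0 < x < pi -> 0 <= cot_ratio_concavity x.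
Proof.
move=> xpi; have [x0 xp] := andP xpi.
have xpi' : 0 <= x <= pi by rewrite !ltW.
have B0 := sin_gap_gt0 xpi; have s0 := sin_gt0_pi xpi.
rewrite /cot_ratio_concavity divr_ge0 ?exprn_ge0 ?(ltW B0)// mulr_ge0//.
have j0 := sq_gap_ge0 xpi'; have lb := sin_gap_lb xpi'.
have jE : sq_gap x =
    x ^+ 2 * sin x ^+ 2 - 3 * sin x * sin_gap x + sin_gap x ^+ 2.
  by rewrite /sq_gap /sin_gap; ring: (sin2cos2 x).
move: jE lb j0 B0; set a := x ^+ 2 * sin x; set B := sin_gap x => jE lb j0 B0.
have [aB|Ba] := leP a B.
  by rewrite addr_ge0 ?exprn_ge0 ?(ltW B0)// mulr_ge0// subr_ge0.
suff : (a - B) * (a * B / 5) <= (a - B) * (sin x * (3 * B - a)).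
  move=> h; suff : 0 <= B ^+ 3 + (B - a) * (a * sin x - 3 * sin x * B + B ^+ 2).
    rewrite jE (_ : x ^+ 2 * sin x ^+ 2 = a * sin x)//.
    by rewrite /a; ring.
  rewrite (_ : _ + _ = B * ((a - 3 * B) ^+ 2 + B ^+ 2) / 5
      + ((a - B) * (sin x * (3 * B - a)) - (a - B) * (a * B / 5))); last first.
    by field.
  rewrite addr_ge0 ?subr_ge0// divr_ge0// mulr_ge0 ?(ltW B0)//.
  by rewrite addr_ge0 ?sqr_ge0.
rewrite ler_wpM2l ?subr_ge0 ?(ltW Ba)//.
rewrite -subr_ge0.
rewrite (_ : _ - _ = sin x * ((15 - x ^+ 2) * B - 5 * x ^+ 2 * sin x) / 5).
  by rewrite divr_ge0// mulr_ge0 ?subr_ge0// ltW.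
by rewrite /a; field.
Qed.

Lemma cot_ratio_tangent x r : 0 < x < pi -> 0 < r < pi ->
  cot_ratio x <= cot_ratio r - r * sq_gap r / sin_gap r ^+ 2 * (x - r).
Proof.
move=> xpi rpi.
pose a := Num.min x r; pose b := Num.max x r.
have ab y : a <= y <= b -> 0 < y < pi.
  move=> /andP[ay yb]; rewrite (lt_le_trans _ ay) ?(le_lt_trans yb)//.
    by rewrite /b gt_max; case/andP: xpi => _ ->; case/andP: rpi.
  by rewrite /a lt_min; case/andP: xpi => ->; case/andP: rpi.
have B0 y : a <= y <= b -> sin_gap y != 0.
  by move=> /ab/sin_gap_gt0 ?; rewrite gt_eqF.
have D1 (y : R) : a <= y <= b ->
    is_derive y 1 (fun z => - cot_ratio z) (y * sq_gap y / sin_gap y ^+ 2).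
  move=> yab; have := is_derive_cot_ratio (B0 _ yab) => D.
  by rewrite -[X in is_derive _ _ _ X]opprK; exact: is_deriveN.
have D2 (y : R) yab := is_derive2_cot_ratio (B0 y yab).
have d0 y : a < y < b -> 0 <= cot_ratio_concavity y.
  move=> /andP[ay yb]; apply: cot_ratio_concavity_ge0.
  by apply: ab; rewrite !ltW.
have := @tangent_below R _ _ _ a b r x D1 D2 d0.
rewrite /a /b !ge_min !le_max !lexx !orbT => /(_ isT isT).
set c := _ / _; lra.
Qed.

(** For m = -1 the right-hand side is the tangent at r, evaluated at x; it grows
    with m because [sq_gap] is nonnegative. *)
Lemma cot_ratio_le x r m : 0 < x < pi -> 0 < r < pi -> -1 <= m ->
  cot_ratio x <=
    (r ^+ 2 * (r ^+ 2 - sin r ^+ 2) + x * m * r * sq_gap r) / sin_gap r ^+ 2.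
Proof.
move=> xpi rpi m1; have [x0 _] := andP xpi; have [r0 rp] := andP rpi.
have B0 := sin_gap_gt0 rpi.
have j0 : 0 <= sq_gap r by apply: sq_gap_ge0; rewrite !ltW.
apply: (le_trans (cot_ratio_tangent xpi rpi)); rewrite -subr_ge0.
have -> : cot_ratio r =
    (r ^+ 2 * (r ^+ 2 - sin r ^+ 2) - r ^+ 2 * sq_gap r) / sin_gap r ^+ 2.
  have := lt0r_neq0 B0; rewrite /cot_ratio /sq_gap /sin_gap => Bn0.
  by field: (sin2cos2 r).
rewrite (_ : _ - _ = (m + 1) * (x * r * sq_gap r) / sin_gap r ^+ 2).
  by rewrite divr_ge0 ?sqr_ge0// !mulr_ge0 ?(ltW x0) ?(ltW r0)// -lerBlDr sub0r.
by field; rewrite lt0r_neq0.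
Qed.
End Trig.

(** * Second derivative of the squared distance *)

Section SquaredDistance.
Variable R : realType.

(** Half of the second derivative of |v|^2 - d(y, exp_x v)^2 along a unit
    direction of the tangent space, at a point v with |v| = r and
    d(y, exp_x v) = th.  Here c and s are the radial and tangential components of
    the direction, in the plane that it spans with v; m and n are the
    components, in the image of that plane, of the unit vector at exp_x v which
    points to y.  They satisfy only m^2 + n^2 <= 1, as y need not lie in the great
    sphere generated by that plane.

    With k = 1 - th cot th, L = sin_gap r / r^2, Q = sq_gap r / r^3 and
    u = n c - m (sin r / r) s, the expression is at least
    k u^2 - 2 th L s u + s^2 (1 - (sin r / r)^2 + th m Q), and the discriminant
    of this form in u and s is controlled by [cot_ratio_le]. *)
Lemma cross_curvature_ge0 (th r c s m n : R) : 0 < th < pi -> 0 < r < pi ->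
  c ^+ 2 + s ^+ 2 = 1 -> m ^+ 2 + n ^+ 2 <= 1 ->
  0 <= 1 - (m * c + n * (sin r / r) * s) ^+ 2 * (1 - th * (cos th / sin th))
    + th * (- (cos th / sin th) * (c ^+ 2 + (sin r / r) ^+ 2 * s ^+ 2)
            + m * s ^+ 2 * ((r - sin r * cos r) / r ^+ 2)
            - 2 * n * s * c * (sin_gap r / r ^+ 2)).
Proof.
move=> thpi rpi cs1 mn1.
have [th0 _] := andP thpi; have [r0 _] := andP rpi.
have B0 := sin_gap_gt0 rpi; have Bth0 := sin_gap_gt0 thpi.
have sth0 := sin_gt0_pi thpi.
set k := 1 - th * _.
have kE : k = sin_gap th / sin th by rewrite /k /sin_gap; field; rewrite lt0r_neq0.
have k0 : 0 < k by rewrite kE divr_gt0.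
have cotE : cos th / sin th = (1 - k) / th.
  by rewrite /k; field; rewrite !lt0r_neq0.
have m1 : -1 <= m.
  have : m ^+ 2 <= 1 by rewrite (le_trans _ mn1)// lerDl sqr_ge0.
  nra.
have := cot_ratio_le thpi rpi m1; rewrite -subr_ge0.
set w := cot_ratio th; set D := _ - _ => D0.
pose sg := sin r / r.
pose L := sin_gap r / r ^+ 2; pose Q := sq_gap r / r ^+ 3.
have key : 0 <= k * (1 - sg ^+ 2 + th * m * Q) - th ^+ 2 * L ^+ 2.
  rewrite (_ : _ - _ = k * L ^+ 2 * D).
    by rewrite mulr_ge0// mulr_ge0 ?sqr_ge0 ?(ltW k0).
  rewrite /D /w /cot_ratio kE /L /Q /sg; field.
  by rewrite !lt0r_neq0.
pose u := n * c - m * sg * s.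
have MQ : (r - sin r * cos r) / r ^+ 2 = Q + 2 * sg * L.
  rewrite /Q /sg /L /sq_gap /sin_gap; have := lt0r_neq0 r0 => rn0.
  by field.
rewrite cotE MQ -/L -/sg.
(* complete the square in u; the last term is what Bessel's inequality
   m ^+ 2 + n ^+ 2 <= 1 leaves over *)
rewrite (_ : _ + _ = ((k * u - th * L * s) ^+ 2
   + s ^+ 2 * (k * (1 - sg ^+ 2 + th * m * Q) - th ^+ 2 * L ^+ 2)) / k
   + k * ((c ^+ 2 + sg ^+ 2 * s ^+ 2) * (1 - (m ^+ 2 + n ^+ 2)))); last first.
  have c2 : c ^+ 2 = 1 - s ^+ 2 by rewrite -cs1 addrK.
  have kn0 := lt0r_neq0 k0; have thn0 := lt0r_neq0 th0.
  rewrite /u; clearbody sg L Q k.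
  by field: c2; rewrite kn0 thn0.
rewrite addr_ge0// ?divr_ge0 ?(ltW k0)//.
  by rewrite addr_ge0 ?sqr_ge0// mulr_ge0 ?sqr_ge0.
rewrite mulr_ge0 ?(ltW k0)// mulr_ge0 ?subr_ge0//.
by rewrite addr_ge0 ?sqr_ge0// mulr_ge0 ?sqr_ge0.
Qed.

(** The pointwise hypothesis is the sign of half the second derivative of
    x^2 - acos (A x)^2.  The quadratic term is moved to the right-hand side, where
    it becomes t (1 - t) (b - a)^2. *)
Lemma acos_curve_convex (A dA ddA : R -> R) (a b t : R) :
  a <= b -> 0 <= t <= 1 ->
  (forall x : R, is_derive x 1 A (dA x)) ->
  (forall x : R, is_derive x 1 dA (ddA x)) ->
  (forall x, -1 < A x < 1) ->
  (forall x th, a < x < b -> 0 < th < pi -> cos th = A x ->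
    0 <= 1 - (dA x / sin th) ^+ 2 * (1 - th * (cos th / sin th))
         + th * (ddA x / sin th)) ->
  (1 - t) * acos (A a) ^+ 2 + t * acos (A b) ^+ 2 <=
    acos (A ((1 - t) * a + t * b)) ^+ 2 + t * (1 - t) * (b - a) ^+ 2.
Proof.
move=> ab t01 D1 D2 A1 H.
pose th (x : R) := acos (A x).
have sthE x : sin (th x) = Num.sqrt (1 - A x ^+ 2).
  by rewrite sin_acos//; case/andP: (A1 x) => ? ?; rewrite !ltW.
have sth0 x : 0 < sin (th x).
  rewrite sthE sqrtr_gt0 subr_gt0; have := A1 x; nra.
have Dth (x : R) : is_derive x 1 th (- (dA x / sin (th x))).
  have D := is_derive1_acos (A1 x).
  have := is_derive1_comp D (D1 x); rewrite -sthE mulNr mulrC; exact.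
pose f (x : R) := x ^+ 2 - th x ^+ 2.
pose df (x : R) := 2 * x + 2 * th x * (dA x / sin (th x)).
pose ddf (x : R) := 2 *
  (1 - (dA x / sin (th x)) ^+ 2 * (1 - th x * (cos (th x) / sin (th x)))
   + th x * (ddA x / sin (th x))).
have Df (x : R) : is_derive x 1 f (df x).
  by apply: is_derive_eq; rewrite !/GRing.scale/= /df; ring.
have Ddf (x : R) : is_derive x 1 df (ddf x).
  have Dst : is_derive x 1 (fun y => sin (th y))
      (cos (th x) * - (dA x / sin (th x))).
    exact: (is_derive1_comp (is_derive_sin (th x)) (Dth x)).
  have DV := @is_deriveV R (fun y => sin (th y)) x _ 1 (lt0r_neq0 (sth0 x)) Dst.
  apply: is_derive_eq; rewrite !/GRing.scale/= /ddf; field.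
  by rewrite lt0r_neq0.
have ddf0 x : a < x < b -> 0 <= ddf x.
  move=> xab; rewrite mulr_ge0//; have /andP[Al Ar] := A1 x.
  apply: H => //; first by rewrite acos_gt0 ?acos_ltpi ?Al ?Ar ?ltW.
  by rewrite acosK// in_itv/= !ltW.
have := convex_of_second_derivative ab t01 Df Ddf ddf0.
rewrite /f /th; lra.
Qed.

(** In an orthonormal frame (e0, e1, e2), the inner product of the vector with
    coordinates (X0, X1, X2) with exp_e0 (rho e1 + x e2): the line runs in the
    direction e2 at distance rho from the origin. *)
Definition line_dot (X0 X1 X2 rho x : R) : R :=
  let r := Num.sqrt (rho ^+ 2 + x ^+ 2) in
  X0 * cos r + sin r / r * (rho * X1 + x * X2).

(** The line avoids the origin of the tangent space, so polar coordinates are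
    smooth along it: v = rho e1 + x e2 has r = |v|, and its direction has radial
    and tangential components x / r and rho / r. *)
Lemma acos_line_convex (X0 X1 X2 rho a b t : R) : 0 < rho ->
  X0 ^+ 2 + X1 ^+ 2 + X2 ^+ 2 < 1 -> a <= b -> 0 <= t <= 1 ->
  rho ^+ 2 + a ^+ 2 <= pi ^+ 2 -> rho ^+ 2 + b ^+ 2 <= pi ^+ 2 ->
  (1 - t) * acos (line_dot X0 X1 X2 rho a) ^+ 2
    + t * acos (line_dot X0 X1 X2 rho b) ^+ 2 <=
  acos (line_dot X0 X1 X2 rho ((1 - t) * a + t * b)) ^+ 2
    + t * (1 - t) * (b - a) ^+ 2.
Proof.
move=> rho0 X1lt ab t01 api bpi; set A := line_dot X0 X1 X2 rho.
pose q (x : R) := rho ^+ 2 + x ^+ 2; pose r (x : R) := Num.sqrt (q x).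
have q0 x : 0 < q x by rewrite ltr_wpDr ?sqr_ge0// exprn_gt0.
have r0 x : 0 < r x by rewrite sqrtr_gt0.
have r2 x : r x ^+ 2 = rho ^+ 2 + x ^+ 2 by rewrite sqr_sqrtr// ltW.
have rn0 x : r x != 0 by rewrite lt0r_neq0.
have Dr (x : R) : is_derive x 1 r (x / r x).
  have Dq : is_derive x 1 q (2 * x).
    by apply: is_derive_eq; rewrite !/GRing.scale/=; ring.
  have := is_derive1_comp (is_derive1_sqrt (q0 x)) Dq.
  by congr is_derive; rewrite -/(r x); field.
(* C' = - x S and S' = x E: no square root appears in the derivatives *)
pose C (x : R) := cos (r x); pose S (x : R) := sin (r x) / r x.
pose E (x : R) := (C x - S x) / r x ^+ 2.
have DC (x : R) : is_derive x 1 C (- x * S x).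
  have := is_derive1_comp (is_derive_cos (r x)) (Dr x).
  by congr is_derive; rewrite /S; field.
have DV (x : R) := @is_deriveV R r x _ 1 (rn0 x) (Dr x).
have DS (x : R) : is_derive x 1 S (x * E x).
  have Ds := is_derive1_comp (is_derive_sin (r x)) (Dr x).
  have := is_deriveM Ds (DV x).
  by congr is_derive; rewrite /E /S /C /GRing.scale/=; field.
have DV2 (x : R) : is_derive x 1 (fun y => (r y ^+ 2)^-1) (- 2 * x / r x ^+ 4).
  have D2 : is_derive x 1 (fun y => r y ^+ 2) (2 * x).
    by apply: is_derive_eq; rewrite /GRing.scale/=; field.
  have := @is_deriveV R (fun y => r y ^+ 2) x _ 1 _ D2.
  rewrite expf_neq0// => /(_ isT); congr is_derive.
  by rewrite /GRing.scale/=; field.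
have DE (x : R) : is_derive x 1 E (- x * (S x + 3 * E x) / r x ^+ 2).
  apply: is_derive_eq; rewrite /GRing.scale/= /E; field.
  by [].
pose N (x : R) := rho * X1 + x * X2.
have DN (x : R) : is_derive x 1 N X2.
  by apply: is_derive_eq; rewrite /GRing.scale/=; ring.
pose dA (x : R) := - X0 * (x * S x) + x * E x * N x + S x * X2.
pose ddA (x : R) := - X0 * (S x + x ^+ 2 * E x) + E x * N x
  - x ^+ 2 * N x * (S x + 3 * E x) / r x ^+ 2 + 2 * x * E x * X2.
have DA (x : R) : is_derive x 1 A (dA x).
  have : is_derive x 1 (fun y => X0 * C y + S y * N y) (dA x).
    by apply: is_derive_eq; rewrite /GRing.scale/= /dA; ring.
  exact.
have DdA (x : R) : is_derive x 1 dA (ddA x).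
  apply: is_derive_eq; rewrite /GRing.scale/= /ddA; field.
  by [].
have rho2 x : rho ^+ 2 = r x ^+ 2 - x ^+ 2 by rewrite r2 addrK.
have AE x : A x = X0 * cos (r x) + sin (r x) / r x * (rho * X1 + x * X2) by [].
(* components of X along the radial and the tangential unit vectors at
   exp_e0 v; together with A they give all of X *)
pose Xr x := - sin (r x) * X0 + cos (r x) * N x / r x.
pose Xt x := (rho * X2 - x * X1) / r x.
have bessel x : Xr x ^+ 2 + Xt x ^+ 2 + A x ^+ 2 = X0 ^+ 2 + X1 ^+ 2 + X2 ^+ 2.
  rewrite /Xr /Xt AE /N; field: (rho2 x) (sin2cos2 (r x)).
  by [].
have A1 x : -1 < A x < 1.
  by have := bessel x; have := sqr_ge0 (Xr x); have := sqr_ge0 (Xt x); nra.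
apply: (acos_curve_convex ab t01 DA DdA A1) => x th /andP[ax xb] thpi cth.
have sth0 := sin_gt0_pi thpi; have sthn0 := lt0r_neq0 sth0.
have rpi : 0 < r x < pi.
  rewrite r0/= -(ltr_pXn2r (ltn0Sn 1)) ?nnegrE ?pi_ge0 ?ltW// r2.
  have [x0|x0] := leP 0 x.
    have : 0 < (b - x) * (b + x) by rewrite mulr_gt0//; lra.
    lra.
  have : 0 < (x - a) * (- a - x) by rewrite mulr_gt0//; lra.
  lra.
have c2s2 : (x / r x) ^+ 2 + (rho / r x) ^+ 2 = 1.
  by field: (rho2 x).
have mn1 : (Xr x / sin th) ^+ 2 + (Xt x / sin th) ^+ 2 <= 1.
  rewrite (expr_div_n (Xr x)) (expr_div_n (Xt x)) -mulrDl.
  rewrite ler_pdivrMr ?exprn_gt0// mul1r (sin2cos2 th) cth.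
  by have := bessel x; lra.
have := cross_curvature_ge0 thpi rpi c2s2 mn1.
congr (_ <= _).
rewrite cth /dA /ddA /E /Xr /Xt AE /N /S /C /sin_gap.
field: (rho2 x) (sin2cos2 (r x)).
by rewrite sthn0 rn0.
Qed.

(** A line through the origin is mapped to a great circle, parametrized by arc
    length.  Then A'' = - A, and the second derivative is
    (1 - th cot th) (1 - A'^2 / sin^2 th). *)
Lemma acos_line_origin_convex (X0 X2 a b t : R) :
  X0 ^+ 2 + X2 ^+ 2 < 1 -> a <= b -> 0 <= t <= 1 ->
  let A (x : R) := X0 * cos x + X2 * sin x in
  ((1 - t) * acos (A a) ^+ 2 + t * acos (A b) ^+ 2 <=
    acos (A ((1 - t) * a + t * b)) ^+ 2 + t * (1 - t) * (b - a) ^+ 2 : Prop).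
Proof.
move=> X1lt ab t01 A.
pose dA (x : R) := - X0 * sin x + X2 * cos x.
have DA (x : R) : is_derive x 1 A (dA x).
  by apply: is_derive_eq; rewrite /GRing.scale/= /dA; ring.
have DdA (x : R) : is_derive x 1 dA (- A x).
  by apply: is_derive_eq; rewrite /GRing.scale/= /A; ring.
have bessel x : dA x ^+ 2 + A x ^+ 2 = X0 ^+ 2 + X2 ^+ 2.
  by rewrite /dA /A; ring: (sin2cos2 x).
have A1 x : -1 < A x < 1.
  by have := bessel x; have := sqr_ge0 (dA x); nra.
apply: (acos_curve_convex ab t01 DA DdA A1) => x th /andP[ax xb] thpi cth.
have sth0 := sin_gt0_pi thpi; have sthn0 := lt0r_neq0 sth0.
rewrite -cth (_ : _ + _ = sin_gap th / sin th * (1 - (dA x / sin th) ^+ 2)).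
  rewrite mulr_ge0 ?divr_ge0 ?(ltW sth0) ?(ltW (sin_gap_gt0 _))//.
  rewrite subr_ge0 expr_div_n ler_pdivrMr ?exprn_gt0// mul1r (sin2cos2 th) cth.
  by have := bessel x; lra.
by rewrite /sin_gap; field.
Qed.
End SquaredDistance.

(** * Continuity of the arc cosine up to the end points *)

Section Limit.
Variable R : realType.
Local Open Scope classical_set_scope.

(** Continuity at the end point, where [acos] is not differentiable, comes from
    [acos] being the inverse of a continuous function on a segment. *)
Lemma acos_cvg1 : acos y @[y --> (1 : R)^'-] --> acos 1.
Proof.
have /continuous_within_itvP : {within `[-1, 1], continuous (@acos R)}.
  rewrite -(cospi R) -(cos0 R).
  apply: segment_can_ge_continuous; [exact: pi_ge0| |exact: cosK].
  by apply: continuous_subspaceT => x; exact: continuous_cos.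
by rewrite -subr_gt0 opprK => /(_ ltac:(by []))[].
Qed.

Lemma acosM_cvg (c : R) : -1 <= c <= 1 ->
  acos (k * c) @[k --> (1 : R)^'-] --> acos c.
Proof.
move=> /andP[]; rewrite le_eqVlt => /predU1P[<- _|c1].
  have -> : acos (-1) = pi - acos 1 :> R by rewrite acosN1 acos1 subr0.
  apply: (@cvg_trans _ ((fun k : R => pi - acos k) @ 1^'-)); last first.
    by apply: cvgB; [exact: cvg_cst|exact: acos_cvg1].
  apply: near_eq_cvg; near=> k; rewrite mulrN1 acosN//.
  by apply/andP; split; near: k; [apply: nbhs_left_ge; lra|exact: nbhs_left_le].
rewrite le_eqVlt => /predU1P[->|c2].
  under eq_fun do rewrite mulr1.
  exact: acos_cvg1.
apply: continuous_cvg; first by apply: continuous_acos; rewrite c1.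
rewrite -[X in _ --> X]mul1r.
apply: cvgMr_tmp; apply: cvg_at_left_filter; exact: cvg_id.
Unshelve. all: by end_near. Qed.

(** Removes the factor k < 1 that keeps the inner products away from the end
    points -1 and 1. *)
Lemma acos_convex_limit (c0 c1 c t D : R) :
  -1 <= c0 <= 1 -> -1 <= c1 <= 1 -> -1 <= c <= 1 ->
  (forall k, 0 <= k < 1 -> (1 - t) * acos (k * c0) ^+ 2 + t * acos (k * c1) ^+ 2
     <= acos (k * c) ^+ 2 + D) ->
  (1 - t) * acos c0 ^+ 2 + t * acos c1 ^+ 2 <= acos c ^+ 2 + D.
Proof.
move=> h0 h1 h H.
have sq u : -1 <= u <= 1 ->
    (acos (k * u) ^+ 2) @[k --> (1 : R)^'-] --> acos u ^+ 2.
  by move=> hu; rewrite expr2; apply: cvgM; exact: acosM_cvg.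
apply: (@ler_cvg_to _ (1 : R)^'- _ _
  (fun k => (1 - t) * acos (k * c0) ^+ 2 + t * acos (k * c1) ^+ 2)
  (fun k => acos (k * c) ^+ 2 + D)).
- by apply: cvgD; apply: cvgMl_tmp; exact: sq.
- by apply: cvgD; [exact: sq|exact: cvg_cst].
near=> k; apply: H; apply/andP; split; near: k; last exact: nbhs_left_lt.
by apply: nbhs_left_ge.
Unshelve. all: by end_near. Qed.
End Limit.

(** * The exponential map of the sphere *)

Section Vectors.
Variables (R : realType) (m : nat).
Implicit Types (x y u v : 'cV[R]_m) (a : R).

Lemma dotE x y : dot x y = \sum_i x i 0 * y i 0.
Proof. by rewrite /dot mxE; apply: eq_bigr => i _; rewrite mxE. Qed.

Lemma dotC x y : dot x y = dot y x.
Proof. by rewrite !dotE; apply: eq_bigr => i _; rewrite mulrC. Qed.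

Lemma dotDr x u v : dot x (u + v) = dot x u + dot x v.
Proof. by rewrite /dot mulmxDr mxE. Qed.

Lemma dotZr a x y : dot x (a *: y) = a * dot x y.
Proof. by rewrite /dot -scalemxAr mxE. Qed.

Lemma dotNr x y : dot x (- y) = - dot x y.
Proof. by rewrite -scaleN1r dotZr mulN1r. Qed.

Lemma dotDl x u v : dot (u + v) x = dot u x + dot v x.
Proof. by rewrite dotC dotDr !(dotC x). Qed.

Lemma dotZl a x y : dot (a *: x) y = a * dot x y.
Proof. by rewrite dotC dotZr dotC. Qed.

Lemma dotNl x y : dot (- x) y = - dot x y.
Proof. by rewrite dotC dotNr dotC. Qed.

Lemma dot0r x : dot x 0 = 0.
Proof. by rewrite /dot mulmx0 mxE. Qed.

Definition dot_lin := (dotDl, dotDr, dotZl, dotZr, dotNl, dotNr).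

Lemma dot_ge0 x : 0 <= dot x x.
Proof. by rewrite dotE sumr_ge0// => i _; rewrite -expr2 sqr_ge0. Qed.

Lemma dot_eq0 x : dot x x = 0 -> x = 0.
Proof.
rewrite dotE => /eqP; rewrite psumr_eq0; last first.
  by move=> i _; rewrite -expr2 sqr_ge0.
move=> /allP h; apply/matrixP => i j; rewrite ord1 mxE; apply/eqP.
by have := h i (mem_index_enum _); rewrite mulf_eq0 orbb.
Qed.

(** The vectors may be shorter than 1, in particular zero, so that a degenerate
    frame needs no separate treatment. *)
Lemma bessel3 x u v w : dot u u <= 1 -> dot v v <= 1 -> dot w w <= 1 ->
  dot u v = 0 -> dot u w = 0 -> dot v w = 0 ->
  dot x u ^+ 2 + dot x v ^+ 2 + dot x w ^+ 2 <= dot x x.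
Proof.
move=> u1 v1 w1 uv uw vw.
have := dot_ge0 (x - dot x u *: u - dot x v *: v - dot x w *: w).
rewrite !dot_lin (dotC v u) (dotC w u) (dotC w v).
rewrite (dotC u x) (dotC v x) (dotC w x) uv uw vw.
have h (z : 'cV[R]_m) : dot z z <= 1 -> 0 <= dot x z ^+ 2 * (1 - dot z z).
  by move=> z1; rewrite mulr_ge0 ?sqr_ge0 ?subr_ge0.
have := h _ u1; have := h _ v1; have := h _ w1; lra.
Qed.

Lemma dot_itv x y : dot x x = 1 -> dot y y = 1 -> -1 <= dot x y <= 1.
Proof.
move=> x1 y1; have := dot_ge0 (x + y); have := dot_ge0 (x - y).
by rewrite !dot_lin x1 y1 (dotC y x); lra.
Qed.

(** Riemannian exponential map of the unit sphere at x.  At v = 0 the coefficient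
    sin r / r is 0 rather than 1, which does no harm as it multiplies v. *)
Definition sphere_exp x v : 'cV[R]_m :=
  let r := Num.sqrt (dot v v) in cos r *: x + (sin r / r) *: v.

Lemma dot_sphere_exp y x v : let r := Num.sqrt (dot v v) in
  dot y (sphere_exp x v) = cos r * dot y x + sin r / r * dot y v.
Proof. by rewrite /sphere_exp !dot_lin. Qed.

Lemma sphere_exp_unit x v : dot x x = 1 -> dot x v = 0 ->
  dot (sphere_exp x v) (sphere_exp x v) = 1.
Proof.
move=> x1 xv; rewrite /sphere_exp !dot_lin (dotC v x) x1 xv.
set r := Num.sqrt _.
have r2 : dot v v = r ^+ 2 by rewrite sqr_sqrtr// dot_ge0.
rewrite r2; have [->|r0] := eqVneq r 0.
  by rewrite sin0 cos0; ring.
by field: (sin2cos2 r).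
Qed.

(** The segment from v0 to v1 is parametrized by arc length on the line that
    carries it: v = f + s e, where e is its unit direction and f the foot of the
    perpendicular from 0.  With e1 the unit vector along f, or 0 when f = 0, the
    statement becomes one about the coordinates of z in (x, e1, e). *)
Lemma acos_exp_convex_shrunk x z v0 v1 t k :
  dot x x = 1 -> dot z z = 1 -> dot x v0 = 0 -> dot x v1 = 0 ->
  dot v0 v0 <= pi ^+ 2 -> dot v1 v1 <= pi ^+ 2 -> 0 <= t <= 1 -> 0 <= k < 1 ->
  (1 - t) * acos (k * dot z (sphere_exp x v0)) ^+ 2
    + t * acos (k * dot z (sphere_exp x v1)) ^+ 2 <=
  acos (k * dot z (sphere_exp x ((1 - t) *: v0 + t *: v1))) ^+ 2
    + t * (1 - t) * dot (v1 - v0) (v1 - v0).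
Proof.
move=> x1 z1 xv0 xv1 v0pi v1pi t01 /andP[k0 k1].
have [/dot_eq0/subr0_eq ->|l2n0] := eqVneq (dot (v1 - v0) (v1 - v0)) 0.
  by rewrite subrr dot0r mulr0 addr0 -mulrDl -scalerDl !subrK mul1r scale1r.
have l20 : 0 < dot (v1 - v0) (v1 - v0) by rewrite lt0r l2n0 dot_ge0.
pose l := Num.sqrt (dot (v1 - v0) (v1 - v0)).
have l0 : 0 < l by rewrite sqrtr_gt0.
have l2 : dot (v1 - v0) (v1 - v0) = l ^+ 2 by rewrite sqr_sqrtr// ltW.
pose e := l^-1 *: (v1 - v0).
have ee : dot e e = 1.
  by rewrite /e dotZl dotZr l2; field; rewrite lt0r_neq0.
have xe : dot x e = 0 by rewrite /e !dot_lin xv0 xv1 subrr mulr0.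
have le : l *: e = v1 - v0 by rewrite scalerA divff ?scale1r// lt0r_neq0.
clearbody e; pose a := dot v0 e; pose f := v0 - a *: e.
have fe : dot f e = 0 by rewrite /f !dot_lin ee /a; ring.
have v0E : v0 = f + a *: e by rewrite subrK.
have xf : dot x f = 0 by rewrite /f !dot_lin xv0 xe mulr0 subrr.
clearbody f a.
have v1E : v1 = f + (a + l) *: e by rewrite scalerDl addrA -v0E le addrC subrK.
have vtE : (1 - t) *: v0 + t *: v1 = f + ((1 - t) * a + t * (a + l)) *: e.
  by rewrite v1E v0E !scalerDr !scalerA addrACA -!scalerDl subrK scale1r.
pose rho := Num.sqrt (dot f f).
have rho2 : dot f f = rho ^+ 2 by rewrite sqr_sqrtr// dot_ge0.
have norm s : dot (f + s *: e) (f + s *: e) = rho ^+ 2 + s ^+ 2.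
  by rewrite !dot_lin (dotC e f) fe ee rho2; ring.
pose e1 := rho^-1 *: f.
have fE : f = rho *: e1.
  have [r0|r0] := eqVneq rho 0; last by rewrite scalerA divff ?scale1r.
  by rewrite r0 scale0r; apply: dot_eq0; rewrite rho2 r0 expr0n.
have e11 : dot e1 e1 <= 1.
  rewrite /e1 dotZl dotZr rho2; have [->|r0] := eqVneq rho 0.
    by rewrite invr0 !mul0r.
  by rewrite le_eqVlt; apply/orP; left; apply/eqP; field.
have e1e : dot e1 e = 0 by rewrite /e1 dotZl fe mulr0.
have xe1 : dot x e1 = 0 by rewrite /e1 dotZr xf mulr0.
clearbody e1.
have bes : (k * dot z x) ^+ 2 + (k * dot z e1) ^+ 2 + (k * dot z e) ^+ 2 < 1.
  have := @bessel3 z x e1 e; rewrite x1 e11 ee lexx z1.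
  move=> /(_ isT isT isT xe1 xe e1e); rewrite !exprMn -!mulrDr => h.
  apply: (le_lt_trans (y := k ^+ 2)); first by rewrite ler_piMr ?sqr_ge0.
  by rewrite expr_lt1.
rewrite l2 vtE.
have dz s : k * dot z (sphere_exp x (f + s *: e)) =
  line_dot (k * dot z x) (k * dot z e1) (k * dot z e) rho s.
  by rewrite dot_sphere_exp norm /line_dot fE !dot_lin; ring.
have al : a <= a + l by rewrite lerDl ltW.
have api : rho ^+ 2 + a ^+ 2 <= pi ^+ 2 by rewrite -norm -v0E.
have alpi : rho ^+ 2 + (a + l) ^+ 2 <= pi ^+ 2 by rewrite -norm -v1E.
rewrite v1E v0E !dz.
have -> : l ^+ 2 = (a + l - a) ^+ 2 by rewrite addrAC subrr add0r.
have : 0 <= rho by exact: sqrtr_ge0.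
rewrite le_eqVlt => /predU1P[r0|r0]; last exact: acos_line_convex.
(* the line passes through 0; evenness of cos and of sin r / r replaces |s| by s *)
have lineE s : line_dot (k * dot z x) (k * dot z e1) (k * dot z e) rho s =
    k * dot z x * cos s + k * dot z e * sin s.
  rewrite /line_dot -r0 expr0n add0r sqrtr_sqr mul0r add0r.
  have [->|s0] := eqVneq s 0; first by rewrite normr0 sin0; ring.
  have [s1|s1] := leP 0 s; rewrite ?(ger0_norm s1) ?(ltr0_norm s1) ?cosN ?sinN.
    by field.
  by field.
rewrite !lineE; apply: acos_line_origin_convex => //.
by apply: le_lt_trans bes; rewrite lerD2r lerDl sqr_ge0.
Qed.

(** Nonnegative cross-curvature of the sphere: |v|^2 - d(z, exp_x v)^2 is convex
    on the ball of radius pi, the quadratic term being moved to the right. *)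
Lemma acos_exp_convex x z v0 v1 t :
  dot x x = 1 -> dot z z = 1 -> dot x v0 = 0 -> dot x v1 = 0 ->
  dot v0 v0 <= pi ^+ 2 -> dot v1 v1 <= pi ^+ 2 -> 0 <= t <= 1 ->
  (1 - t) * acos (dot z (sphere_exp x v0)) ^+ 2
    + t * acos (dot z (sphere_exp x v1)) ^+ 2 <=
  acos (dot z (sphere_exp x ((1 - t) *: v0 + t *: v1))) ^+ 2
    + t * (1 - t) * dot (v1 - v0) (v1 - v0).
Proof.
move=> x1 z1 xv0 xv1 v0pi v1pi t01.
have itv v : dot x v = 0 -> -1 <= dot z (sphere_exp x v) <= 1.
  by move=> xv; apply: dot_itv => //; apply: sphere_exp_unit.
apply: acos_convex_limit; [exact: itv|exact: itv| |].
  by apply: itv; rewrite !dot_lin xv0 xv1 !mulr0 addr0.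
by move=> k k01; apply: acos_exp_convex_shrunk.
Qed.
End Vectors.

(** * Costs along a segment in the tangent space *)

Section Sphere.
Variables (R : realType).

(** The unit tangent vector u is used when y is the antipode of x, where the
    initial direction of a minimizing geodesic is arbitrary. *)
Lemma sphere_exp_onto m (x y u : 'cV[R]_m) : dot x x = 1 -> dot y y = 1 ->
  dot x u = 0 -> dot u u = 1 ->
  exists v,
    [/\ dot x v = 0, dot v v = acos (dot x y) ^+ 2 & sphere_exp x v = y].
Proof.
move=> x1 y1 xu u1; have /andP[c1 c2] := dot_itv x1 y1.
set c := dot x y in c1 c2 *; set d := acos c.
have cd : cos d = c by rewrite acosK// in_itv/= c1.
have d0 : 0 <= d by rewrite acos_ge0// c1.
suff [w [xw w1 ws]] :
    exists w, [/\ dot x w = 0, dot w w = 1 & sin d *: w = y - c *: x].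
  have vd : dot (d *: w) (d *: w) = d ^+ 2 by rewrite dotZl dotZr w1 mulr1 expr2.
  exists (d *: w); split=> //; first by rewrite dotZr xw mulr0.
  rewrite /sphere_exp vd sqrtr_sqr ger0_norm// cd scalerA.
  have -> : sin d / d * d = sin d.
    by have [->|dn0] := eqVneq d 0; [rewrite sin0 mulr0|rewrite divfK].
  by rewrite ws addrC subrK.
have yc : dot (y - c *: x) (y - c *: x) = sin d ^+ 2.
  by rewrite sin2cos2 cd !dot_lin x1 y1 (dotC y x) -/c; ring.
have [s0|s0] := eqVneq (sin d) 0.
  exists u; split=> //; rewrite s0 scale0r; apply/esym/dot_eq0.
  by rewrite yc s0 expr0n.
exists ((sin d)^-1 *: (y - c *: x)); split.
- by rewrite !dot_lin x1 -/c; ring.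
- by rewrite dotZl dotZr yc; field.
- by rewrite scalerA divff// scale1r.
Qed.

(** Only the zero-dimensional sphere, which consists of two antipodal points, has
    no unit tangent vector; the hypothesis says this without coordinates. *)
Lemma no_unit_tangent m (x y : 'cV[R]_m) : dot x x = 1 -> dot y y = 1 ->
  ~ (exists u, dot x u = 0 /\ dot u u = 1) -> y = x \/ dot y x = -1.
Proof.
move=> x1 y1 nu; pose w := y - dot x y *: x.
have xw : dot x w = 0 by rewrite /w !dot_lin x1; ring.
have [w0|w0] := eqVneq (dot w w) 0; last first.
  pose N := Num.sqrt (dot w w).
  have N0 : N != 0 by rewrite sqrtr_eq0 -ltNge lt0r w0 dot_ge0.
  have N2 : dot w w = N ^+ 2 by rewrite sqr_sqrtr// dot_ge0.
  case: nu; exists (N^-1 *: w); rewrite dotZr xw mulr0 dotZl dotZr N2.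
  by split=> //; field.
have /subr0_eq yE := dot_eq0 w0.
have : dot x y ^+ 2 = 1 by rewrite -[RHS]y1 {2 3}yE !dot_lin x1; ring.
move/eqP; rewrite sqrf_eq1 => /orP[/eqP c1|/eqP c1]; [left|right].
  by rewrite yE c1 scale1r.
by rewrite dotC.
Qed.

Variable n : nat.
Implicit Types x y z : sphere R n.

Lemma sphere_dot x : dot (val x) (val x) = 1.
Proof. exact: eqP (valP x). Qed.

Lemma costC x y : cost x y = cost y x.
Proof. by rewrite /cost /gdist dotC. Qed.

Lemma cost_itv x y : 0 <= cost x y <= 2^-1 * pi ^+ 2.
Proof.
have h := dot_itv (sphere_dot x) (sphere_dot y).
have := acos_ge0 h; have := acos_lepi h; rewrite /cost /gdist => h1 h2.
by rewrite mulr_ge0 ?sqr_ge0//= ler_wpM2l// ler_sqr ?nnegrE// pi_ge0.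
Qed.

Lemma cost_diag x : cost x x = 0.
Proof. by rewrite /cost /gdist sphere_dot acos1 expr0n mulr0. Qed.

(** The pole z is the point of parameter t on the image under exp_x of the segment
    joining preimages of y0 and y1.  On the zero-dimensional sphere, z = x works
    because the cost of antipodal points is maximal. *)
Lemma c_segment x y0 y1 t : 0 <= t <= 1 -> exists z, forall y,
  cost x z - cost y z <=
    (1 - t) * (cost x y0 - cost y y0) + t * (cost x y1 - cost y y1).
Proof.
move=> t01; have [t0 t1] := andP t01.
have [[u [xu u1]]|nu] := pselect (exists u, dot (val x) u = 0 /\ dot u u = 1);
    last first.
  exists x => y.
  have [/val_inj ->|yx] := no_unit_tangent (sphere_dot x) (sphere_dot y) nu.
    by rewrite !subrr !mulr0 addr0.
  rewrite cost_diag (_ : cost y x = 2^-1 * pi ^+ 2); last first.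
    by rewrite /cost /gdist yx acosN1.
  have := cost_itv x y0; have := cost_itv y y0.
  have := cost_itv x y1; have := cost_itv y y1.
  set p := _ * pi ^+ 2; nra.
have x1 := sphere_dot x.
have [v0 [xv0 v0d v0y]] := sphere_exp_onto x1 (sphere_dot y0) xu u1.
have [v1 [xv1 v1d v1y]] := sphere_exp_onto x1 (sphere_dot y1) xu u1.
have ball y : acos (dot (val x) (val y)) ^+ 2 <= pi ^+ 2.
  have h := dot_itv x1 (sphere_dot y).
  by rewrite ler_sqr ?nnegrE ?acos_lepi ?acos_ge0 ?pi_ge0.
pose v := (1 - t) *: v0 + t *: v1.
have xv : dot (val x) v = 0 by rewrite /v !dot_lin xv0 xv1 !mulr0 addr0.
have vE : dot v v = (1 - t) * dot v0 v0 + t * dot v1 v1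
    - t * (1 - t) * dot (v1 - v0) (v1 - v0).
  by rewrite /v !dot_lin (dotC v1 v0); ring.
have vpi : dot v v <= pi ^+ 2.
  have := dot_ge0 (v1 - v0); have := ball y0; have := ball y1.
  rewrite vE v0d v1d => h1 h0 h.
  have : 0 <= t * (1 - t) * dot (v1 - v0) (v1 - v0).
    by rewrite !mulr_ge0// subr_ge0.
  nra.
have zP : dot (sphere_exp (val x) v) (sphere_exp (val x) v) == 1.
  by apply/eqP; apply: sphere_exp_unit.
have xz : acos (dot (val x) (sphere_exp (val x) v)) ^+ 2 = dot v v.
  rewrite dot_sphere_exp xv x1 mulr0 addr0 mulr1 cosK ?sqr_sqrtr ?dot_ge0//.
  rewrite in_itv/= sqrtr_ge0/= -(ger0_norm (pi_ge0 R)) -sqrtr_sqr.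
  by rewrite ler_wsqrtr.
exists (exist _ (sphere_exp (val x) v) zP) => y.
have := acos_exp_convex x1 (sphere_dot y) xv0 xv1 (t := t).
rewrite v0d v1d v0y v1y !ball t01 => /(_ isT isT isT).
rewrite /cost /gdist /= xz vE v0d v1d -/v; lra.
Qed.
End Sphere.

(** * Cost-convexity *)

(** The double transform at x is the supremum over z of the values at x of the
    functions y |-> a - cost y z lying below phi, so it equals phi x exactly when
    some of them come within e of phi x.  The slack e makes compactness
    unnecessary: the supremum need not be attained. *)
Lemma cconvex_supportP (R : realType) (n : nat) (phi : sphere R n -> R) :
  cconvex phi <->
  forall x e, 0 < e ->
    exists z, forall y, phi x + cost x z - cost y z - e <= phi y.
Proof.
rewrite /cconvex; set psi := ctransform (fun x => (phi x)%:E).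
have psi_ge y z : ((- cost y z - phi y)%:E <= psi z)%E.
  by apply: ereal_sup_ubound; exists y => //; rewrite EFinB EFinN.
split=> [h x e e0|h].
  have : ((phi x - e)%:E < ctransform psi x)%E.
    by rewrite h lte_fin ltrBlDr ltrDl.
  move=> /ereal_sup_gt[_ [z _ <-]] p; exists z => y; move: p (psi_ge y z).
  case: (psi z) => [r| |]; [|by rewrite ltNge leNye|by rewrite leeNy_eq].
  rewrite -EFinN -EFinB lte_fin !lee_fin (costC z x); lra.
apply/funext => x; apply/eqP; rewrite eq_le; apply/andP; split.
  apply: ub_ereal_sup => _ [z _ <-]; move: (psi_ge x z).
  case: (psi z) => [r| |]; [|by rewrite leNye|by rewrite leeNy_eq].
  rewrite -EFinN -EFinB !lee_fin (costC z x); lra.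
apply/lee_addgt0Pr => e e0; have [z hz] := h x e e0.
have psiz : (psi z <= (e - cost x z - phi x)%:E)%E.
  apply: ub_ereal_sup => _ [y _ <-]; rewrite -EFinN -EFinB lee_fin.
  by have := hz y; lra.
have : ((- cost z x)%:E - psi z <= ctransform psi x)%E.
  by apply: ereal_sup_ubound; exists z => //.
move=> /(leeD2r e%:E); apply: le_trans.
move: psiz (psi_ge x z).
case: (psi z) => [r| |]; [|by rewrite leye_eq|by rewrite leeNy_eq].
rewrite -EFinB -EFinD !lee_fin (costC z x); lra.
Qed.

Theorem lemma1 (R : realType) (n : nat) (phi0 phi1 : sphere R n -> R)
    (h0 : cconvex phi0) (h1 : cconvex phi1) (t : R) (ht : 0 <= t <= 1) :
  cconvex (fun x : sphere R n => (1 - t) * phi0 x + t * phi1 x).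
Proof.
apply/cconvex_supportP => x e e0; have /andP[t0 t1] := ht.
have [y0 hy0] := (cconvex_supportP phi0).1 h0 x e e0.
have [y1 hy1] := (cconvex_supportP phi1).1 h1 x e e0.
have [z hz] := c_segment x y0 y1 ht; exists z => y.
have t1' : 0 <= 1 - t by rewrite subr_ge0.
have := ler_wpM2l t1' (hy0 y); have := ler_wpM2l t0 (hy1 y); have := hz y.
lra.
Qed.
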